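(* Let $\Phi$ be a unit norm tight frame in $\mathbb{R}^d$ with $K$ atoms, frame constant $K/d$ and coherence $\mu$, and let $1\le S\le K$. Let $x$ be drawn from a symmetric probability distribution $\nu$ on $S^{K-1}$ and let $y=\Phi x$. Suppose there exists $\kappa>0$ such that $$\nu\Big(\min_{p,\sigma}\Big(\|P_{I_p}(\Phi)\Phi c_{p,\sigma}(x)\|_2-\max_{|I|\le S,\ I\neq I_p}\|P_I(\Phi)\Phi c_{p,\sigma}(x)\|_2\Big)\ge2\kappa\Big)=1,$$ where $I_p:=p^{-1}(\{1,\dots,S\})$ and the minimum is over all permutations $p$ and sign sequences $\sigma$. Then $\Phi$ is a local maximum of $\max_{\Psi\in\mathcal D}\mathbb{E}_y\big(\max_{|I|\le S}\|P_I(\Psi)y\|_2^2\big)$.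
   Context: $\mathcal D$ is the set of dictionaries $\Psi=(\psi_1,\dots,\psi_K)$, $\psi_i\in\mathbb{R}^d$, $\|\psi_i\|_2=1$; $P_I(\Psi)=\Psi_I\Psi_I^\dagger$ is the orthogonal projection onto the span of $(\psi_i)_{i\in I}$. A probability measure on $S^{K-1}$ is symmetric if invariant under coordinate sign flips and coordinate permutations. For $x\in S^{K-1}$, $c(x)=(c_1(x),\dots,c_K(x))$ is the non-increasing rearrangement of $(|x_1|,\dots,|x_K|)$, and $c_{p,\sigma}(x)(i)=\sigma_ic_{p(i)}(x)$. Unit norm tight frame: $\sum_i|\langle\phi_i,v\rangle|^2=(K/d)\|v\|_2^2$; coherence $\mu=\max_{i\ne j}|\langle\phi_i,\phi_j\rangle|$. *)

(* Defs.v *)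
From HB Require Import structures.
From mathcomp Require Import all_boot all_order all_algebra all_fingroup.
From mathcomp Require Import all_classical all_reals all_analysis.
Set Implicit Arguments. Unset Strict Implicit. Unset Printing Implicit Defensive.
Import Order.TTheory GRing.Theory Num.Theory.
Local Open Scope ring_scope.
Local Open Scope classical_set_scope.

Section Defs.
Variable R : realType.

Definition norm2sq n (v : 'cV[R]_n) : R := \sum_i (v i 0) ^+ 2.
Definition norm2 n (v : 'cV[R]_n) : R := Num.sqrt (norm2sq v).

Definition frob_dist m n (A B : 'M[R]_(m, n)) : R :=
  Num.sqrt (\sum_i \sum_j (A i j - B i j) ^+ 2).

(* Moore-Penrose pseudo-inverse: the unique X satisfying the Penrose equations *)
Definition penrose m n (A : 'M[R]_(m, n)) (X : 'M[R]_(n, m)) : Prop :=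
  [/\ A *m X *m A = A, X *m A *m X = X, (A *m X)^T = A *m X & (X *m A)^T = X *m A].
Definition pinv m n (A : 'M[R]_(m, n)) : 'M[R]_(n, m) := xget 0 (penrose A).

(* Psi_I : Psi with the columns outside I replaced by 0 (same column span as
   the submatrix (psi_i)_{i in I}) *)
Definition colsI d K (Psi : 'M[R]_(d, K)) (I : {set 'I_K}) : 'M[R]_(d, K) :=
  Psi *m diag_mx (\row_j ((j \in I)%:R : R)).

(* P_I(Psi) = Psi_I Psi_I^dagger, orthogonal projection onto span (psi_i)_{i in I} *)
Definition projI d K (Psi : 'M[R]_(d, K)) (I : {set 'I_K}) : 'M[R]_d :=
  colsI Psi I *m pinv (colsI Psi I).

Definition atom d K (Psi : 'M[R]_(d, K)) (i : 'I_K) : 'cV[R]_d := col i Psi.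

Definition dictionary d K (Psi : 'M[R]_(d, K)) : Prop :=
  forall i, norm2 (atom Psi i) = 1.

Definition unit_norm_tight_frame d K (Phi : 'M[R]_(d, K)) : Prop :=
  dictionary Phi /\
  forall v : 'cV[R]_d,
    \sum_i ((atom Phi i)^T *m v) 0 0 ^+ 2 = (K%:R / d%:R) * norm2sq v.

Definition coherence d K (Phi : 'M[R]_(d, K)) : R :=
  \big[Num.max/0]_(i : 'I_K) \big[Num.max/0]_(j : 'I_K | j != i)
     `|((atom Phi i)^T *m atom Phi j) 0 0|.

Definition tvec K (x : K.-tuple R) : 'cV[R]_K := \col_i tnth x i.

(* c(x): non-increasing rearrangement of (|x_1|,...,|x_K|) (0-indexed) *)
Definition crearr K (x : 'cV[R]_K) (i : 'I_K) : R :=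
  nth 0 (sort (fun a b : R => b <= a) [seq `|x j 0| | j <- enum 'I_K]) i.

Definition cps K (p : 'S_K) (s : 'I_K -> bool) (x : 'cV[R]_K) : 'cV[R]_K :=
  \col_i ((-1) ^+ s i * crearr x (p i)).

(* I_p = p^{-1}({1,...,S}) (0-indexed: indices i with p i < S) *)
Definition Ip K (S : nat) (p : 'S_K) : {set 'I_K} := [set i | (p i < S)%N].

Definition signperm K (s : 'S_K) (sg : 'I_K -> bool) (x : K.-tuple R) : K.-tuple R :=
  [tuple (-1) ^+ sg i * tnth x (s i) | i < K].

Definition symmetric_on_sphere K (nu : probability (K.-tuple R) R) : Prop :=
  nu [set x | norm2sq (tvec x) = 1] = 1%E /\
  forall (s : 'S_K) (sg : 'I_K -> bool) (A : set (K.-tuple R)),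
    measurable A -> nu (signperm s sg @^-1` A) = nu A.

Definition best_Sterm d K (S : nat) (Psi : 'M[R]_(d, K)) (y : 'cV[R]_d) : R :=
  \big[Num.max/0]_(I : {set 'I_K} | (#|I| <= S)%N) norm2sq (projI Psi I *m y).

Definition objective d K (S : nat) (nu : probability (K.-tuple R) R)
    (Phi Psi : 'M[R]_(d, K)) : \bar R :=
  (\int[nu]_x (best_Sterm S Psi (Phi *m tvec x))%:E)%E.

Definition local_max_on_D d K (F : 'M[R]_(d, K) -> \bar R) (Phi : 'M[R]_(d, K)) : Prop :=
  dictionary Phi /\
  exists eps : R, 0 < eps /\
    forall Psi : 'M[R]_(d, K), dictionary Psi -> frob_dist Psi Phi < eps ->
      (F Psi <= F Phi)%E.

End Defs.

(* Main.v *)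
(** The gap condition forces every [Phi_I] with [|I| <= S] to have linearly
    independent columns, so [P_I(Psi)] depends Lipschitz-continuously on [Psi]
    at [Phi], and for [Psi] close to [Phi] the set [I_p] still attains
    [max_I |P_I(Psi) Phi c_{p,sigma}(x)|] almost surely.  By symmetry of [nu] the
    objective is the expectation of the average over [p] and [sigma].  Averaging
    over signs kills the cross terms and leaves
    [sum_i c_{p(i)}^2 |P_{I_p}(Psi) phi_i|^2]; averaging over [p] makes the weight
    of [c_j^2] depend only on whether [j < S].  Since [c] is non-increasing, it
    is enough to compare, for each [I = I_p], the sum of [|P_I(Psi) phi_i|^2] over
    [i] in [I], which is at most [sum_{i in I} |phi_i|^2] with equality at [Phi],
    and the sum over all [i], which by tightness is [(K/d) tr P_I(Psi)] and hence at
    most [(K/d) |I|], again with equality at [Phi]. *)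
Require Import Defs.
From HB Require Import structures.
From mathcomp Require Import all_boot all_order all_algebra all_fingroup.
From mathcomp Require Import all_classical all_reals all_analysis.
From mathcomp Require Import measurable_realfun ring lra.
Import Order.TTheory GRing.Theory Num.Theory.
Local Open Scope ring_scope.

Set Implicit Arguments.
Unset Strict Implicit.
Unset Printing Implicit Defensive.

(** * Frobenius norm, pseudo-inverses and orthogonal projections *)

Section LinearAlgebra.
Variable R : realType.

(** Lagrange's identity: the two sides differ by half the sum of all squares
    [(a i * b j - a j * b i) ^+ 2]. *)
Lemma cauchy_schwarz_sum (T : finType) (a b : T -> R) :
  (\sum_i a i * b i) ^+ 2 <= (\sum_i a i ^+ 2) * (\sum_i b i ^+ 2).
Proof.
have : 0 <= \sum_i \sum_j (a i * b j - a j * b i) ^+ 2.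
  by apply: sumr_ge0 => i _; apply: sumr_ge0 => j _; exact: sqr_ge0.
have -> : \sum_i \sum_j (a i * b j - a j * b i) ^+ 2 =
    \sum_i \sum_j (a i ^+ 2 * b j ^+ 2) + \sum_i \sum_j (a j ^+ 2 * b i ^+ 2)
    - 2 * \sum_i \sum_j ((a i * b i) * (a j * b j)).
  rewrite mulr_sumr -big_split -sumrB /=; apply: eq_bigr => i _.
  rewrite mulr_sumr -big_split -sumrB /=; apply: eq_bigr => j _; ring.
have -> : \sum_i \sum_j (a j ^+ 2 * b i ^+ 2) = \sum_i \sum_j (a i ^+ 2 * b j ^+ 2).
  by rewrite exchange_big.
by rewrite -!big_distrlr /= -expr2; lra.
Qed.

Definition frob2 m n (M : 'M[R]_(m, n)) : R := \sum_i \sum_j M i j ^+ 2.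

Lemma norm2sqE n (v : 'cV[R]_n) : norm2sq v = frob2 v.
Proof. by apply: eq_bigr => i _; rewrite big_ord1. Qed.

Lemma frob2_ge0 m n (M : 'M[R]_(m, n)) : 0 <= frob2 M.
Proof. by apply: sumr_ge0 => i _; apply: sumr_ge0 => j _; exact: sqr_ge0. Qed.

Lemma frob2_eq0 m n (M : 'M[R]_(m, n)) : frob2 M = 0 -> M = 0.
Proof.
move=> /eqP; rewrite psumr_eq0 => [/allP M0|i _]; last first.
  by apply: sumr_ge0 => j _; exact: sqr_ge0.
apply/matrixP => i j; rewrite mxE.
have := M0 i (mem_index_enum _); rewrite psumr_eq0 => [/allP|? _]; last exact: sqr_ge0.
by move=> /(_ j (mem_index_enum _)); rewrite sqrf_eq0 => /eqP.
Qed.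

Lemma frob2_tr m n (M : 'M[R]_(m, n)) : frob2 M = \tr (M *m M^T).
Proof.
apply: eq_bigr => i _; rewrite mxE; apply: eq_bigr => j _.
by rewrite mxE expr2.
Qed.

Lemma frob2_trV m n (M : 'M[R]_(m, n)) : frob2 M = \tr (M^T *m M).
Proof. by rewrite mxtrace_mulC frob2_tr. Qed.

Lemma frob2N m n (M : 'M[R]_(m, n)) : frob2 (- M) = frob2 M.
Proof. by apply: eq_bigr => i _; apply: eq_bigr => j _; rewrite mxE sqrrN. Qed.

Lemma frob2_mul m n p (A : 'M[R]_(m, n)) (B : 'M[R]_(n, p)) :
  frob2 (A *m B) <= frob2 A * frob2 B.
Proof.
rewrite /frob2 [X in _ <= _ * X]exchange_big /= mulr_suml; apply: ler_sum => i _.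
rewrite mulr_sumr; apply: ler_sum => j _; rewrite mxE; exact: cauchy_schwarz_sum.
Qed.

Lemma norm2_sqr n (v : 'cV[R]_n) : norm2 v ^+ 2 = norm2sq v.
Proof. by rewrite /norm2 sqr_sqrtr // norm2sqE frob2_ge0. Qed.

Lemma norm2_ge0 n (v : 'cV[R]_n) : 0 <= norm2 v.
Proof. exact: sqrtr_ge0. Qed.

Lemma norm2D n (u v : 'cV[R]_n) : norm2 (u + v) <= norm2 u + norm2 v.
Proof.
rewrite -ler_sqr ?nnegrE ?addr_ge0 ?norm2_ge0 // sqrrD !norm2_sqr.
have cs : \sum_i u i 0 * v i 0 <= norm2 u * norm2 v.
  apply: (le_trans (ler_norm _)).
  rewrite -ler_sqr ?nnegrE ?mulr_ge0 ?norm2_ge0 //.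
  rewrite exprMn !norm2_sqr real_normK ?num_real //; exact: cauchy_schwarz_sum.
have -> : norm2sq (u + v) = norm2sq u + norm2sq v + 2 * \sum_i u i 0 * v i 0.
  rewrite /norm2sq mulr_sumr -!big_split /=; apply: eq_bigr => i _.
  rewrite mxE; ring.
rewrite -mulr_natr; lra.
Qed.

Lemma norm2N n (v : 'cV[R]_n) : norm2 (- v) = norm2 v.
Proof. by rewrite /norm2 !norm2sqE frob2N. Qed.

(** If [N] annihilates the Gram matrix, then [frob2 (N *m A)] is the trace of
    [N *m (A *m A^T) *m N^T], which is zero; row freeness then cancels [A]. *)
Lemma gram_unitmx m n (A : 'M[R]_(m, n)) : row_free A -> A *m A^T \in unitmx.
Proof.
move=> Afree; rewrite -row_free_unit -kermx_eq0; apply/eqP.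
set N := kermx _.
have NA : N *m A = 0.
  apply: frob2_eq0; rewrite frob2_tr trmx_mul mulmxA -(mulmxA N) mulmx_ker.
  by rewrite mul0mx mxtrace0.
by apply: (row_free_inj Afree); rewrite NA mul0mx.
Qed.

(** The classical pseudo-inverse of a full-rank factorization. The two products with [C *m B]
    collapse to [C *m H *m C^T] and [B^T *m G *m B], both symmetric. *)
Lemma penrose_full_rank m n r (C : 'M[R]_(m, r)) (B : 'M[R]_(r, n)) :
  B *m B^T \in unitmx -> C^T *m C \in unitmx ->
  penrose (C *m B) (B^T *m invmx (B *m B^T) *m invmx (C^T *m C) *m C^T).
Proof.
move=> uB uC; set G := invmx (B *m B^T); set H := invmx (C^T *m C).
have BG : B *m B^T *m G = 1%:M by rewrite mulmxV.
have HC : H *m (C^T *m C) = 1%:M by rewrite mulVmx.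
have GT : G^T = G by rewrite trmx_inv trmx_mul trmxK.
have HT : H^T = H by rewrite trmx_inv trmx_mul trmxK.
have AX : C *m B *m (B^T *m G *m H *m C^T) = C *m H *m C^T.
  by rewrite !mulmxA -(mulmxA C B) -(mulmxA C (B *m _)) BG mulmx1.
have XA : B^T *m G *m H *m C^T *m (C *m B) = B^T *m G *m B.
  by rewrite !mulmxA -(mulmxA _ C^T C) -(mulmxA _ H) HC mulmx1.
split.
- by rewrite AX !mulmxA -(mulmxA _ C^T C) -(mulmxA _ H) HC mulmx1.
- by rewrite XA !mulmxA -(mulmxA _ B B^T) -(mulmxA _ (B *m B^T)) BG mulmx1.
- by rewrite AX !trmx_mul trmxK HT mulmxA.
- by rewrite XA !trmx_mul trmxK GT mulmxA.
Qed.

(** Since [pinv] is a choice with default [0], its equations rest on the existence of a solution,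
    which the factorization into [col_base] and [row_base] supplies. *)
Lemma penrose_pinv m n (A : 'M[R]_(m, n)) : penrose A (Defs.pinv A).
Proof.
apply: xgetPex; rewrite -{1}(mulmx_base A).
eexists; apply: penrose_full_rank; first exact/gram_unitmx/row_base_free.
rewrite -[X in _ *m X]trmxK; apply: gram_unitmx.
by rewrite /row_free mxrank_tr; exact: col_base_full.
Qed.

Definition orthoproj n (P : 'M[R]_n) := P^T = P /\ P *m P = P.

Lemma orthoproj_frob2 n p (P : 'M[R]_n) (M : 'M[R]_(n, p)) : orthoproj P ->
  frob2 M = frob2 (P *m M) + frob2 (M - P *m M).
Proof.
move=> [PT PP]; rewrite !frob2_trV -raddfD /=; congr (\tr _).
rewrite [(M - P *m M)^T]linearB /= trmx_mul PT mulmxBr !mulmxBl !mulmxA.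
by rewrite -(mulmxA M^T P P) PP subrr subr0 addrC subrK.
Qed.

Lemma orthoproj_frob2_le n p (P : 'M[R]_n) (M : 'M[R]_(n, p)) : orthoproj P ->
  frob2 (P *m M) <= frob2 M.
Proof. by move=> hP; rewrite (orthoproj_frob2 M hP) lerDl frob2_ge0. Qed.

Lemma orthoproj_compl_frob2_le n p (P : 'M[R]_n) (M : 'M[R]_(n, p)) : orthoproj P ->
  frob2 (M - P *m M) <= frob2 M.
Proof. by move=> hP; rewrite (orthoproj_frob2 M hP) lerDr frob2_ge0. Qed.

Lemma orthoproj_tr n (P : 'M[R]_n) : orthoproj P -> frob2 P = \tr P.
Proof. by move=> [PT PP]; rewrite frob2_tr PT PP. Qed.

(** The diagonal entry is the squared norm of its row, hence at least its own square. *)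
Lemma orthoproj_diag n (P : 'M[R]_n) i : orthoproj P -> P i i <= 1.
Proof.
have sqr_le (x : R) : x ^+ 2 <= x -> x <= 1 by nra.
move=> hP; have [PT PP] := hP.
have Pii : P i i = \sum_k P i k ^+ 2.
  rewrite -{1}PP mxE; apply: eq_bigr => k _.
  by rewrite -{2}PT mxE expr2.
apply: sqr_le; rewrite {2}Pii (bigD1 i) //= lerDl sumr_ge0 // => k _.
exact: sqr_ge0.
Qed.

Lemma col_mulmx m n p (A : 'M[R]_(m, n)) (B : 'M[R]_(n, p)) j :
  col j (A *m B) = A *m col j B.
Proof. by rewrite !colE mulmxA. Qed.

(** * Projections onto spans of atoms *)

Section Atoms.
Variables (d K : nat).
Implicit Types (Phi Psi : 'M[R]_(d, K)) (I J : {set 'I_K}).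

Definition maskI I : 'M[R]_K := diag_mx (\row_j (j \in I)%:R).

Lemma maskI_mul I J : maskI I *m maskI J = maskI (I :&: J).
Proof.
rewrite /maskI mulmx_diag; congr diag_mx; apply/rowP => j.
by rewrite !mxE inE -natrM mulnb.
Qed.

Lemma maskI_tr I : \tr (maskI I) = #|I|%:R.
Proof.
rewrite /maskI mxtrace_diag; under eq_bigr do rewrite mxE.
rewrite -natr_sum; congr _%:R.
rewrite -sum1_card [RHS]big_mkcond.
by apply: eq_bigr => j _; case: (j \in I).
Qed.

Lemma colsIE Psi I i j : colsI Psi I i j = Psi i j * (j \in I)%:R.
Proof. by rewrite /colsI mul_mx_diag !mxE. Qed.

Lemma colsI_mask I J Psi : colsI Psi I *m maskI J = colsI Psi (I :&: J).
Proof. by rewrite /colsI -mulmxA -/(maskI _) maskI_mul. Qed.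

Lemma projI_ortho Psi I : orthoproj (projI Psi I).
Proof.
have [h1 h2 h3 h4] := penrose_pinv (colsI Psi I).
by split; rewrite /projI // mulmxA h1.
Qed.

Lemma projI_cols Psi I : projI Psi I *m colsI Psi I = colsI Psi I.
Proof. by have [h1 h2 h3 h4] := penrose_pinv (colsI Psi I). Qed.

Lemma projI_atom Psi I i : i \in I -> projI Psi I *m atom Psi i = atom Psi i.
Proof.
move=> iI.
have <- : col i (colsI Psi I) = atom Psi i.
  apply/colP => k; rewrite !mxE (bigD1 i) //= !mxE eqxx iI mulr1n mulr1.
  by rewrite big1 ?addr0 // => j /negPf ji; rewrite !mxE ji mulr0n mulr0.
by rewrite -col_mulmx projI_cols.
Qed.

(** The product is symmetric, so it equals its transpose, whose left factor [(colsI Psi I)^T] has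
    zero rows outside [I]. *)
Lemma pinv_colsI_mask Psi I :
  maskI I *m (Defs.pinv (colsI Psi I) *m colsI Psi I) = Defs.pinv (colsI Psi I) *m colsI Psi I.
Proof.
have [h1 h2 h3 h4] := penrose_pinv (colsI Psi I).
rewrite -h4 trmx_mul {2 4}/colsI trmx_mul tr_diag_mx !mulmxA.
by rewrite -/(maskI I) maskI_mul finset.setIid.
Qed.

(** Cyclicity of the trace passes to the projection [E] on coefficient space. Its rows outside [I]
    vanish, so only [#|I|] diagonal entries, each at most 1, contribute. *)
Lemma projI_tr_le Psi I : \tr (projI Psi I) <= #|I|%:R.
Proof.
have [h1 h2 h3 h4] := penrose_pinv (colsI Psi I).
set E := Defs.pinv (colsI Psi I) *m colsI Psi I.
have hE : orthoproj E by split => //; rewrite /E mulmxA h2.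
have mE : maskI I *m E = E by exact: pinv_colsI_mask.
rewrite /projI mxtrace_mulC -/E -mE -maskI_tr; clearbody E.
apply: ler_sum => i _; rewrite mul_diag_mx !mxE eqxx mulr1n.
by case: (i \in I); rewrite ?mul0r // mul1r orthoproj_diag.
Qed.

(** Linear independence of the atoms in [I]. As [colsI] keeps zero columns, [b] has all [K]
    coordinates and only those in [I] are forced to vanish. *)
Definition indepI Phi I :=
  forall b : 'cV[R]_K, colsI Phi I *m b = 0 -> maskI I *m b = 0.

Lemma indepI_sub Phi I J : I \subset J -> indepI Phi J -> indepI Phi I.
Proof.
move=> /finset.setIidPr IJ hJ b; rewrite -IJ -colsI_mask -mulmxA => /hJ.
by rewrite mulmxA maskI_mul IJ.
Qed.

Lemma indepI_pinv Phi I : indepI Phi I ->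
  Defs.pinv (colsI Phi I) *m colsI Phi I = maskI I.
Proof.
move=> hI; have [h1 h2 h3 h4] := penrose_pinv (colsI Phi I).
set E := Defs.pinv _ *m _.
have A0 : colsI Phi I *m (E - maskI I) = 0.
  by rewrite mulmxBr mulmxA h1 colsI_mask finset.setIid subrr.
have : maskI I *m (E - maskI I) = 0.
  apply/matrixP => i j.
  have : maskI I *m col j (E - maskI I) = 0 by apply: hI; rewrite -col_mulmx A0 col0.
  by rewrite -col_mulmx => /colP/(_ i); rewrite !mxE.
by rewrite mulmxBr pinv_colsI_mask maskI_mul finset.setIid => /eqP; rewrite subr_eq0 => /eqP.
Qed.

Lemma indepI_projI_tr Phi I : indepI Phi I -> \tr (projI Phi I) = #|I|%:R.
Proof. by move=> hI; rewrite /projI mxtrace_mulC indepI_pinv // maskI_tr. Qed.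

Lemma frob2_colsI_le (M : 'M[R]_(d, K)) I : frob2 (colsI M I) <= frob2 M.
Proof.
apply: ler_sum => i _; apply: ler_sum => j _.
rewrite /colsI mul_mx_diag !mxE; case: (_ \in _); rewrite ?mulr1 // mulr0 expr0n /=.
exact: sqr_ge0.
Qed.

(* tr P <= tr Q turns |P - Q|^2 = tr P + tr Q - 2 tr (P Q) into the one-sided
   2 |(1 - P) Q|^2, so no bound on the pseudo-inverse for Psi is needed. *)
Lemma projI_perturbation Phi Psi I : indepI Phi I ->
  frob2 (projI Psi I - projI Phi I)
    <= 2 * frob2 (Defs.pinv (colsI Phi I)) * frob2 (Psi - Phi).
Proof.
move=> hI; set P := projI Psi I; set Q := projI Phi I.
have hP : orthoproj P := projI_ortho Psi I.
have hQ : orthoproj Q := projI_ortho Phi I.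
have [PT PP] := hP; have [QT QQ] := hQ.
have trPQ : \tr P <= \tr Q by rewrite (indepI_projI_tr hI); exact: projI_tr_le.
have e1 : frob2 (P - Q) = \tr P + \tr Q - 2 * \tr (P *m Q).
  rewrite frob2_tr linearB /= PT QT mulmxBl !mulmxBr PP QQ !raddfB /=.
  rewrite (mxtrace_mulC Q P); ring.
have e2 : frob2 (Q - P *m Q) = \tr Q - \tr (P *m Q).
  have := orthoproj_frob2 Q hP; rewrite (orthoproj_tr hQ).
  have -> : frob2 (P *m Q) = \tr (P *m Q).
    by rewrite frob2_trV trmx_mul PT QT mulmxA -(mulmxA Q P P) PP -mulmxA
      mxtrace_mulC -mulmxA QQ.
  by move=> ->; ring.
(* [P] fixes the columns of [colsI Psi I], so [1 - P] does not change when these are subtracted from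
   the factor [colsI Phi I] of [Q]. *)
have e3 : Q - P *m Q = ((colsI Phi I - colsI Psi I)
    - P *m (colsI Phi I - colsI Psi I)) *m Defs.pinv (colsI Phi I).
  rewrite mulmxBr {3}/P projI_cols opprB addrA subrK.
  by rewrite mulmxBl -mulmxA -/(projI Phi I).
have e4 : frob2 (Q - P *m Q) <= frob2 (Psi - Phi) * frob2 (Defs.pinv (colsI Phi I)).
  rewrite e3; apply: (le_trans (frob2_mul _ _)).
  rewrite ler_wpM2r ?frob2_ge0 //.
  apply: (le_trans (orthoproj_compl_frob2_le _ hP)).
  by rewrite /colsI -mulmxBl -(frob2N (Psi - Phi)) opprB; exact: frob2_colsI_le.
rewrite e1; move: e2 e4 trPQ => -> ; clear; lra.
Qed.

(** A relation with a nonzero coefficient at [i] expresses atom [i] through the others in [I], so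
    dropping [i] keeps the span. *)
Lemma not_indepI_projI Phi I : ~ indepI Phi I ->
  exists2 i, i \in I & projI Phi (I :\ i) = projI Phi I.
Proof.
move=> /existsNP[b] /not_implyP[Ab0 /eqP/matrix0Pn[i [j]]].
rewrite ord1 mul_diag_mx !mxE => {j}; case: (boolP (i \in I)); last by rewrite mul0r eqxx.
move=> iI; rewrite mul1r => bi0; exists i => //.
set J := I :\ i.
have JI : I :&: J = J by apply/finset.setIidPr; exact: finset.subsetDl.
(* Column [i] holds the relation solved for atom [i]; the other columns are those of the
   identity. *)
pose X : 'M[R]_K := \matrix_(j, k) (if k == i then - b j 0 / b i 0 else (j == k)%:R).
have inJ j : (j \in J) = (j != i) && (j \in I) by rewrite finset.in_setD1.
have AJX : colsI Phi I = colsI Phi J *m X *m maskI I.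
  apply/matrixP => r k; rewrite colsIE /maskI mul_mx_diag [RHS]mxE.
  rewrite (_ : (\row_j (j \in I)%:R) 0 k = (k \in I)%:R); last by rewrite mxE.
  case: (boolP (k \in I)) => kI; last by rewrite !mulr0.
  rewrite !mulr1 mxE.
  under eq_bigr => j _ do rewrite colsIE [X in _ * X]mxE.
  case: eqVneq => [->|ki]; last first.
    rewrite (bigD1 k) //= big1 ?addr0 => [|j /negPf ->]; last by rewrite mulr0.
    by rewrite eqxx mulr1 inJ ki kI mulr1.
  have := congr1 (fun M : 'cV_d => M r 0) Ab0.
  rewrite [LHS]mxE [RHS]mxE (bigD1 i) //= colsIE iI mulr1.
  move=> /eqP; rewrite addr_eq0 => /eqP e.
  apply: (mulIf bi0); rewrite e [in RHS](bigD1 i) //= inJ eqxx mulr0 mul0r add0r.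
  rewrite mulr_suml -sumrN; apply: eq_bigr => j ji.
  by rewrite inJ ji colsIE /=; field.
have [PT PP] := projI_ortho Phi I; have [QT QQ] := projI_ortho Phi J.
(* Each projection fixes the range of the other; transposing one of these identities makes them
   equal. *)
have PJI : projI Phi J *m projI Phi I = projI Phi I.
  have -> : projI Phi I = colsI Phi J *m (X *m maskI I *m Defs.pinv (colsI Phi I)).
    by rewrite /projI {1}AJX !mulmxA.
  by rewrite mulmxA projI_cols.
have PIJ : projI Phi I *m projI Phi J = projI Phi J.
  have -> : projI Phi J = colsI Phi I *m (maskI J *m Defs.pinv (colsI Phi J)).
    by rewrite mulmxA colsI_mask JI.
  by rewrite mulmxA projI_cols.
by rewrite -QT -PIJ trmx_mul PT QT PJI.
Qed.

(** Exchanging sums and applying tightness to each column of the symmetric [P] gives [K / d] times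
    [frob2 P], which is the trace. *)
Lemma tight_frame_sum_proj Phi (P : 'M[R]_d) :
  (forall v : 'cV[R]_d,
    \sum_i ((atom Phi i)^T *m v) 0 0 ^+ 2 = (K%:R / d%:R) * norm2sq v) ->
  orthoproj P -> \sum_i norm2sq (P *m atom Phi i) = K%:R / d%:R * \tr P.
Proof.
move=> tf hP; have [PT PP] := hP; rewrite exchange_big /= -orthoproj_tr //.
rewrite mulr_sumr; apply: eq_bigr => k _.
have -> : \sum_j P k j ^+ 2 = norm2sq (col k P).
  by apply: eq_bigr => j _; rewrite -{1}PT !mxE.
rewrite -tf; apply: eq_bigr => i _; congr (_ ^+ 2).
rewrite !mxE; apply: eq_bigr => j _; rewrite !mxE mulrC; congr (_ * _).
by rewrite -{1}PT mxE.
Qed.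

End Atoms.
End LinearAlgebra.

(** * Averages over signs and permutations *)

Section Averaging.
Variables (R : realType) (K : nat).
Local Notation signs := {ffun 'I_K -> bool}.

(** For distinct [i] and [j], flipping the sign at [i] is an involution that negates every term. *)
Lemma sum_signs_mul (i j : 'I_K) :
  \sum_(sg : signs) (-1) ^+ sg i * (-1) ^+ sg j = (i == j)%:R * #|signs|%:R :> R.
Proof.
case: eqVneq => [<-|ij].
  under eq_bigr do rewrite -expr2 sqrr_sign.
  by rewrite sumr_const mul1r.
rewrite mul0r; set X := \sum_sg _.
pose flip (sg : signs) : signs := [ffun k => (k == i) (+) sg k].
have flipK : involutive flip by move=> sg; apply/ffunP => k; rewrite !ffunE addKb.
have XN : X = - X.
  rewrite {1}/X (reindex_inj (inv_inj flipK)) -sumrN /=; apply: eq_bigr => sg _.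
  by rewrite !ffunE eqxx eq_sym (negPf ij) addFb signr_addb expr1 mulN1r mulNr.
by move: XN; clear; lra.
Qed.

Lemma sum_signs_sqr (a : 'I_K -> R) :
  \sum_(sg : signs) (\sum_i (-1) ^+ sg i * a i) ^+ 2 = #|signs|%:R * \sum_i a i ^+ 2.
Proof.
transitivity (\sum_i \sum_j a i * a j *
    \sum_(sg : signs) (-1) ^+ sg i * (-1) ^+ sg j).
  under eq_bigr do rewrite expr2 big_distrlr /=.
  rewrite exchange_big /=; apply: eq_bigr => i _.
  rewrite exchange_big /=; apply: eq_bigr => j _.
  by rewrite mulr_sumr; apply: eq_bigr => sg _; ring.
rewrite mulr_sumr; apply: eq_bigr => i _.
under eq_bigr do rewrite sum_signs_mul.
rewrite (bigD1 i) //= big1 ?addr0 => [|j /negPf ji].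
  by rewrite eqxx mul1r; ring.
by rewrite eq_sym ji mul0r mulr0.
Qed.

Lemma sum_signs_norm2sq d (M : 'M[R]_(d, K)) (c : 'I_K -> R) :
  \sum_(sg : signs) norm2sq (M *m \col_i ((-1) ^+ sg i * c i))
    = #|signs|%:R * \sum_i c i ^+ 2 * norm2sq (col i M).
Proof.
rewrite /norm2sq exchange_big /=.
transitivity (\sum_(k < d) #|signs|%:R * \sum_i (M k i * c i) ^+ 2).
  apply: eq_bigr => k _; rewrite -sum_signs_sqr; apply: eq_bigr => sg _.
  by congr (_ ^+ 2); rewrite mxE; apply: eq_bigr => i _; rewrite mxE; ring.
rewrite -mulr_sumr exchange_big /=; congr (_ * _); apply: eq_bigr => i _.
by rewrite mulr_sumr; apply: eq_bigr => k _; rewrite mxE; ring.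
Qed.

Variable S : nat.

(* Reindexing by j = p i, the coefficient of w j is invariant under exchanging two
   positions on the same side of S, so it takes only two values. *)
Lemma sum_perm_ge0 (w : 'I_K -> R) (e : {set 'I_K} -> 'I_K -> R) :
  (1 <= S <= K)%N ->
  (forall j, 0 <= w j) -> (forall i j : 'I_K, (i <= j)%N -> w j <= w i) ->
  (forall p : 'S_K, 0 <= \sum_(i in Ip S p) e (Ip S p) i) ->
  (forall p : 'S_K, 0 <= \sum_i e (Ip S p) i) ->
  0 <= \sum_(p : 'S_K) \sum_i w (p i) * e (Ip S p) i.
Proof.
move=> /andP[S1 SK] w0 wanti e_in e_all.
pose b j := \sum_(p : 'S_K) e (Ip S p) ((p^-1)%g j).
have -> : \sum_(p : 'S_K) \sum_i w (p i) * e (Ip S p) i = \sum_j w j * b j.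
  transitivity (\sum_(p : 'S_K) \sum_j w j * e (Ip S p) ((p^-1)%g j)).
    apply: eq_bigr => p _; rewrite [RHS](reindex_inj (@perm_inj _ p)) /=.
    by apply: eq_bigr => i _; rewrite permK.
  by rewrite exchange_big /=; apply: eq_bigr => j _; rewrite mulr_sumr.
have b_const (j k : 'I_K) : (j < S)%N = (k < S)%N -> b j = b k.
  move=> jk; rewrite /b (reindex_inj (mulIg (tperm j k))) /=; apply: eq_bigr => p _.
  have -> : Ip S (p * tperm j k)%g = Ip S p.
    apply/finset.setP => i; rewrite !inE permM.
    by case: tpermP => [->|->|].
  by rewrite invMg tpermV permM tpermL.
have lt_m : (S.-1 < K)%N by rewrite prednK.
(* The last of the first [S] positions (0-indexed); its weight is a threshold between the weights on
   the two sides of [S]. *)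
pose m := Ordinal lt_m.
have mS : (m < S)%N by rewrite /= prednK.
have sum_p (P : pred 'I_K) : \sum_(j | P j) b j =
    \sum_(p : 'S_K) \sum_(i | P (p i)) e (Ip S p) i.
  rewrite exchange_big /=; apply: eq_bigr => p _.
  rewrite (reindex_inj (@perm_inj _ p)) /=.
  by apply: eq_bigr => i _; rewrite permK.
have bm_ge0 : 0 <= b m.
  have : 0 <= \sum_(j < K | (j < S)%N) b j.
    rewrite sum_p; apply: sumr_ge0 => p _; have := e_in p.
    by congr (_ <= _); apply: eq_bigl => i; rewrite inE.
  rewrite (eq_bigr (fun=> b m)) => [|j jS]; last by apply: b_const; rewrite jS mS.
  rewrite sumr_const pmulrn_lge0 //; apply/card_gt0P; exists m.
  by rewrite unfold_in.
have b_all : 0 <= \sum_j b j.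
  by rewrite sum_p; apply: sumr_ge0 => p _; exact: e_all.
have b_in (j : 'I_K) : (j < S)%N -> 0 <= b j by move=> jS; rewrite (b_const j m) ?jS ?mS.
(* If the common coefficient beyond [S] is nonpositive, replacing every weight by [w m] can only
   lower the sum, and the result is [w m] times a nonnegative total. Otherwise every term is
   nonnegative. *)
have [/existsP[k /andP[kS bk]]|] := boolP [exists k : 'I_K, (S <= k)%N && (b k <= 0)].
  apply: (@le_trans _ _ (w m * \sum_j b j)); first by rewrite mulr_ge0.
  rewrite mulr_sumr; apply: ler_sum => j _; case: (ltnP j S) => jS.
    by rewrite ler_wpM2r ?b_in // wanti // -ltnS prednK.
  rewrite (b_const j k) ?ltnNge ?jS ?kS // ler_wnM2r // wanti //.
  by rewrite /= (leq_trans (leq_pred _)).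
rewrite negb_exists => /forallP b_out; apply: sumr_ge0 => j _; rewrite mulr_ge0 //.
case: (ltnP j S) => [/b_in //|jS].
by have := b_out j; rewrite jS /= -ltNge => /ltW.
Qed.

Lemma card_Ip_le (p : 'S_K) : (S <= K)%N -> (#|Ip S p| <= S)%N.
Proof.
move=> SK; have -> : Ip S p = p @^-1: [set widen_ord SK j | j in 'I_S].
  apply/finset.setP => i; rewrite !inE; apply/idP/imsetP => [piS|[j _ ->]].
    by exists (Ordinal piS) => //; exact: val_inj.
  exact: (ltn_ord j).
rewrite card_preimset; last exact: perm_inj.
by rewrite (leq_trans (leq_imset_card _ _)) // card_ord.
Qed.

(** Listing [I] first and its complement afterwards gives each member of [I] an index below
    [#|I|]. *)
Lemma subset_Ip (I : {set 'I_K}) :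
  (#|I| <= S)%N -> exists p : 'S_K, I \subset Ip S p.
Proof.
move=> IS; pose s := enum I ++ enum (~: I).
have mem_s i : i \in s by rewrite mem_cat !mem_enum inE orbN.
have size_s : size s = K by rewrite size_cat -!cardE cardsC card_ord.
have lt_s i : (index i s < K)%N by rewrite -[X in (_ < X)%N]size_s index_mem.
have inj_s : injective (fun i => Ordinal (lt_s i)).
  move=> i j /(congr1 val) /= /(congr1 (nth i s)).
  by rewrite !nth_index.
exists (perm inj_s); apply/fintype.subsetP => i iI; rewrite inE permE /=.
by rewrite index_cat mem_enum iI (leq_trans _ IS) // cardE index_mem mem_enum.
Qed.

End Averaging.

(** * The non-increasing rearrangement of absolute values *)

Section Rearrangement.
Variables (R : realType) (K : nat).
Implicit Types x : 'cV[R]_K.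
Let geR : rel R := fun a b => b <= a.

Let geR_total : total geR. Proof. by move=> a b; exact: le_total. Qed.
Let geR_trans : transitive geR. Proof. by move=> a b c /[swap]; exact: le_trans. Qed.
Let geR_anti : antisymmetric geR. Proof. by move=> a b; rewrite andbC; exact: le_anti. Qed.

Lemma crearr_perm x : exists q : 'S_K, forall i, crearr x i = `|x (q i) 0|.
Proof.
have /tuple_permP[q qE] : perm_eq (sort geR [seq `|x j 0| | j <- enum 'I_K])
    [tuple `|x j 0| | j < K] by rewrite perm_sort.
by exists q => i; rewrite /crearr -/geR qE nth_mktuple tnth_mktuple.
Qed.

Lemma crearr_ge0 x i : 0 <= crearr x i.
Proof. by have [q ->] := crearr_perm x. Qed.

Lemma crearr_antitone x (i j : 'I_K) : (i <= j)%N -> crearr x j <= crearr x i.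
Proof.
move=> ij; rewrite /crearr -/geR.
have sz : size (sort geR [seq `|x j 0| | j <- enum 'I_K]) = K.
  by rewrite size_sort size_map size_enum_ord.
apply: (sorted_leq_nth geR_trans) => //; first by move=> a; exact: lexx.
- exact: sort_sorted.
- by rewrite inE sz.
- by rewrite inE sz.
Qed.

(** Antisymmetry of the order makes the sorted list unique, so even with ties every sorting
    permutation computes [crearr]. *)
Lemma crearr_sorted x (q : 'S_K) :
  (forall i j : 'I_K, (i <= j)%N -> `|x (q j) 0| <= `|x (q i) 0|) ->
  forall i, crearr x i = `|x (q i) 0|.
Proof.
move=> qs i; pose t : K.-tuple R := [tuple `|x (q j) 0| | j < K].
have st : sorted geR t.
  apply/(sortedP 0) => k; rewrite size_tuple => kK.
  have kK' := ltnW kK.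
  by rewrite -(tnth_nth 0 t (Ordinal kK)) -(tnth_nth 0 t (Ordinal kK')) !tnth_mktuple; exact: qs.
have /(perm_sortP geR_total geR_trans geR_anti) e :
    perm_eq [seq `|x j 0| | j <- enum 'I_K] t.
  rewrite perm_sym; apply/(@tuple_permP _ _ _ [tuple `|x j 0| | j < K]).
  exists q; congr val.
  by apply: eq_from_tnth => j; rewrite !tnth_mktuple.
rewrite /crearr -/geR e sorted_sort // -/(tval t) -tnth_nth tnth_mktuple //.
Qed.

End Rearrangement.

(** * Pointwise consequences of the gap condition *)

Section Deterministic.
Variables (R : realType) (d K S : nat).
Implicit Types (Phi Psi : 'M[R]_(d, K)) (I : {set 'I_K}) (x : 'cV[R]_K).
Local Notation signs := {ffun 'I_K -> bool}.

Lemma norm2sq_cps (p : 'S_K) (sg : 'I_K -> bool) x : norm2sq (cps p sg x) = norm2sq x.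
Proof.
have [q qE] := crearr_perm x.
rewrite [RHS](reindex_inj (@perm_inj _ q)) [RHS](reindex_inj (@perm_inj _ p)) /=.
apply: eq_bigr => i _; rewrite mxE exprMn sqrr_sign mul1r qE.
by rewrite real_normK ?num_real.
Qed.

Lemma norm2_dist n (u v : 'cV[R]_n) (k : R) : norm2 (u - v) <= k ->
  norm2 u <= norm2 v + k /\ norm2 v <= norm2 u + k.
Proof.
move=> uv; split.
  have := norm2D (u - v) v; rewrite subrK => /le_trans; apply.
  by rewrite addrC lerD2l.
have := norm2D (- (u - v)) u; rewrite norm2N opprB subrK => /le_trans; apply.
by rewrite addrC lerD2l.
Qed.

Definition gapped Phi (kappa : R) x := forall (p : 'S_K) (sg : 'I_K -> bool),
  2 * kappa <=
  norm2 (projI Phi (Ip S p) *m (Phi *m cps p sg x))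
  - \big[Num.max/0]_(I : {set 'I_K} | (#|I| <= S)%N && (I != Ip S p))
        norm2 (projI Phi I *m (Phi *m cps p sg x)).

Lemma gapped_lt Phi kappa x (p : 'S_K) (sg : 'I_K -> bool) I :
  gapped Phi kappa x -> (#|I| <= S)%N -> I != Ip S p ->
  norm2 (projI Phi I *m (Phi *m cps p sg x)) + 2 * kappa
    <= norm2 (projI Phi (Ip S p) *m (Phi *m cps p sg x)).
Proof.
move=> /(_ p sg) gap IS Ip.
have := @le_bigmax_cond _ _ _ 0 I
  (fun I : {set 'I_K} => (#|I| <= S)%N && (I != Defs.Ip S p))
  (fun I => norm2 (projI Phi I *m (Phi *m cps p sg x))).
rewrite IS Ip => /(_ isT); move: gap; clear; lra.
Qed.

(** Enlarge [I] to some [Ip S p]. Were that set dependent, dropping an index would give a competitor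
    with the same projection, and the gap would be zero. *)
Lemma gapped_indepI Phi kappa x I : (S <= K)%N -> 0 < kappa ->
  gapped Phi kappa x -> (#|I| <= S)%N -> indepI Phi I.
Proof.
move=> SK k0 gap /subset_Ip[p Isub]; apply: (indepI_sub Isub).
apply: contrapT => /not_indepI_projI[i iI E].
have JS : (#|Ip S p :\ i| <= S)%N.
  by apply: leq_trans (card_Ip_le p SK); exact/subset_leq_card/finset.subsetDl.
have JI : Ip S p :\ i != Ip S p.
  by apply/negP => /eqP/finset.setP/(_ i); rewrite finset.in_setD1 eqxx iI.
have := gapped_lt (p := p) (fun=> false) gap JS JI; rewrite E.
move: k0; clear; lra.
Qed.

(** Passing from [Phi] to [Psi] moves each projection of [y] by at most [kappa], so a gap of
    [2 * kappa] keeps [Ip S p] on top. *)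
Lemma best_Sterm_gapped Phi Psi kappa x (p : 'S_K) (sg : 'I_K -> bool) :
  (S <= K)%N -> 0 < kappa -> norm2sq x = 1 -> gapped Phi kappa x ->
  (forall I, 2 * frob2 (Defs.pinv (colsI Phi I)) * frob2 (Psi - Phi) * frob2 Phi
             <= kappa ^+ 2) ->
  best_Sterm S Psi (Phi *m cps p sg x)
    <= norm2sq (projI Psi (Ip S p) *m (Phi *m cps p sg x)).
Proof.
move=> SK k0 x1 gap close; set y := Phi *m _.
have near I : (#|I| <= S)%N -> norm2 (projI Psi I *m y - projI Phi I *m y) <= kappa.
  move=> IS; rewrite -mulmxBl -ler_sqr ?nnegrE ?norm2_ge0 ?(ltW k0) //.
  rewrite norm2_sqr norm2sqE; apply: le_trans (close I).
  apply: (le_trans (frob2_mul _ _)).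
  apply: ler_pM; rewrite ?frob2_ge0 //.
    by apply: projI_perturbation; exact: gapped_indepI gap IS.
  by apply: (le_trans (frob2_mul _ _)); rewrite -norm2sqE norm2sq_cps x1 mulr1.
apply: bigmax_le => [|I IS]; first by rewrite norm2sqE frob2_ge0.
have [->//|Ip] := eqVneq I (Defs.Ip S p).
rewrite -!norm2_sqr ler_sqr ?nnegrE ?norm2_ge0 //.
have [hI _] := norm2_dist (near _ IS).
have [_ hp] := norm2_dist (near _ (card_Ip_le p SK)).
have hgap : norm2 (projI Phi I *m y) + 2 * kappa <= norm2 (projI Phi (Defs.Ip S p) *m y).
  exact: gapped_lt gap IS Ip.
apply: (le_trans hI); rewrite -(lerD2r kappa); apply: le_trans hp.
by rewrite -addrA -mulr2n -mulr_natl.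
Qed.

Lemma sum_cps_projI_le Phi Psi x : unit_norm_tight_frame Phi -> (1 <= S <= K)%N ->
  (forall I, (#|I| <= S)%N -> indepI Phi I) ->
  \sum_(p : 'S_K) \sum_(sg : signs) norm2sq (projI Psi (Ip S p) *m (Phi *m cps p sg x))
  <= \sum_(p : 'S_K) \sum_(sg : signs)
       norm2sq (projI Phi (Ip S p) *m (Phi *m cps p sg x)).
Proof.
move=> [_ tf] hS indep; have /andP[_ SK] := hS.
have sumE (Theta : 'M[R]_(d, K)) (p : 'S_K) :
    \sum_(sg : signs) norm2sq (projI Theta (Ip S p) *m (Phi *m cps p sg x)) =
    #|signs|%:R * \sum_i crearr x (p i) ^+ 2 *
      norm2sq (projI Theta (Ip S p) *m atom Phi i).
  under eq_bigr do rewrite mulmxA.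
  rewrite sum_signs_norm2sq; congr (_ * _); apply: eq_bigr => i _.
  by rewrite col_mulmx.
under eq_bigr do rewrite sumE.
under [leRHS]eq_bigr do rewrite sumE.
rewrite -!mulr_sumr ler_wpM2l //.
rewrite -subr_ge0 -sumrB; under eq_bigr => p _.
  rewrite -sumrB; under eq_bigr do rewrite -mulrBr.
  over.
(* Here [e] is the energy of an atom captured by [Phi] minus that captured by [Psi]. Over [Ip S p]
   each term is nonnegative since [Phi] captures its own atoms fully; over all atoms tightness
   reduces the sum to a difference of traces. *)
apply: (sum_perm_ge0 (w := fun j => crearr x j ^+ 2)
  (e := fun I i => norm2sq (projI Phi I *m atom Phi i)
                   - norm2sq (projI Psi I *m atom Phi i))) => //.
- by move=> j; exact: sqr_ge0.
- by move=> i j ij; rewrite ler_sqr ?nnegrE ?crearr_ge0 // crearr_antitone.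
- move=> p; apply: sumr_ge0 => i iI; rewrite subr_ge0 projI_atom // !norm2sqE.
  by apply: orthoproj_frob2_le; exact: projI_ortho.
- move=> p; rewrite sumrB !tight_frame_sum_proj //; try exact: projI_ortho.
  have trPhi := indepI_projI_tr (indep _ (card_Ip_le p SK)).
  by rewrite subr_ge0 ler_wpM2l ?divr_ge0 // trPhi projI_tr_le.
Qed.

(** The vectors [x] and [c(x)] lie in one orbit of the signed permutations, so both sums run over
    that orbit: [q] shifts the permutation and [flip] absorbs the signs of the entries of [x]. *)
Lemma sum_signperm_cps (f : 'cV[R]_K -> R) (x : K.-tuple R) :
  \sum_(s : 'S_K) \sum_(sg : signs) f (tvec (signperm s sg x))
  = \sum_(p : 'S_K) \sum_(sg : signs) f (cps p sg (tvec x)).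
Proof.
have [q qE] := crearr_perm (tvec x).
rewrite (reindex_inj (mulIg q)) /=; apply: eq_bigr => p _.
pose flip (sg : signs) : signs := [ffun i => (tnth x (q (p i)) < 0) (+) sg i].
have flipK : involutive flip by move=> sg; apply/ffunP => i; rewrite !ffunE addKb.
rewrite (reindex_inj (inv_inj flipK)) /=; apply: eq_bigr => sg _; congr f.
apply/colP => i; rewrite !mxE tnth_mktuple ffunE permM qE mxE.
by rewrite signr_addb mulrAC [RHS]mulrC -normrEsign.
Qed.

End Deterministic.

Local Open Scope classical_set_scope.

(** * Measurability and invariance of integrals *)

Section Measurability.
Variables (R : realType) (d K : nat).
Local Notation T := (K.-tuple R).
Local Notation mfun f := (measurable_fun [set: T] f).

Lemma measurable_bigmax (I : Type) (r : seq I) (P : pred I) (h : I -> T -> R) :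
  (forall i, mfun (h i)) -> mfun (fun x => \big[Num.max/0]_(i <- r | P i) h i x).
Proof.
move=> mh; elim: r => [|i r ih]; first by under eq_fun do rewrite big_nil; exact: measurable_cst.
under eq_fun do rewrite big_cons; case: (P i) => //.
exact: measurable_maxr.
Qed.

Lemma measurable_norm2sq (M : 'M[R]_(d, K)) (f : T -> 'cV[R]_K) :
  (forall i, mfun (fun x => f x i 0)) -> mfun (fun x => norm2sq (M *m f x)).
Proof.
move=> mf; apply: measurable_sum => k; apply: measurable_funX.
under eq_fun do rewrite mxE; apply: measurable_sum => i.
by apply: measurable_funM => //; exact: measurable_cst.
Qed.

Lemma measurable_norm2 (M : 'M[R]_(d, K)) (f : T -> 'cV[R]_K) :
  (forall i, mfun (fun x => f x i 0)) -> mfun (fun x => norm2 (M *m f x)).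
Proof.
move=> mf; apply: (measurableT_comp (f := @Num.sqrt R)).
  by apply: continuous_measurable_fun; exact: sqrt_continuous.
exact: measurable_norm2sq.
Qed.

Lemma measurable_tvec i : mfun (fun x => tvec x i 0).
Proof. by under eq_fun do rewrite mxE; exact: measurable_tnth. Qed.

Lemma measurable_abs_tvec i : mfun (fun x => `|tvec x i 0|).
Proof.
apply: (measurableT_comp (f := @Num.norm R R)); last exact: measurable_tvec.
exact: normr_measurable.
Qed.

(* crearr is an absolute coordinate function on each of the finitely many cones
   where a given permutation sorts the absolute values. *)
Lemma measurable_crearr i : mfun (fun x => crearr (tvec x) i).
Proof.
move=> _ Y mY; rewrite setTI.
pose E (q : 'S_K) := \bigcap_(ij in [set ij : 'I_K * 'I_K | (ij.1 <= ij.2)%N])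
  [set x : T | `|tvec x (q ij.2) 0| <= `|tvec x (q ij.1) 0|].
have mE q : measurable (E q).
  apply: fin_bigcap_measurable => [|[j k] _]; first exact: finite_finset.
  rewrite -[X in measurable X]setTI; apply: measurable_fun_le => //;
    exact: measurable_abs_tvec.
have Ecrearr q x : E q x -> forall j, crearr (tvec x) j = `|tvec x (q j) 0|.
  by move=> Eq; apply: crearr_sorted => j k jk; exact: (Eq (j, k)).
rewrite [X in measurable X](_ : _ =
    \bigcup_(q in [set: 'S_K]) (E q `&` (fun x => `|tvec x (q i) 0|) @^-1` Y)).
  apply: fin_bigcup_measurable => [|q _]; first exact: finite_finset.
  apply: measurableI => //; rewrite -[X in measurable X]setTI.
  exact: measurable_abs_tvec.
apply/seteqP; split => x /=.
  move=> Yx; have [q qE] := crearr_perm (tvec x); exists q => //; split.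
    by move=> [j k] /= jk; rewrite -!qE; exact: crearr_antitone.
  by rewrite /= -qE.
by move=> [q _ [/Ecrearr qE]] /=; rewrite -qE.
Qed.

Lemma measurable_cps (p : 'S_K) (sg : 'I_K -> bool) i :
  mfun (fun x => cps p sg (tvec x) i 0).
Proof.
under eq_fun do rewrite mxE.
by apply: measurable_funM; [exact: measurable_cst|exact: measurable_crearr].
Qed.

Lemma measurable_gapped (S : nat) (Phi : 'M[R]_(d, K)) (kappa : R) :
  measurable [set x : T | gapped S Phi kappa (tvec x)].
Proof.
rewrite [X in measurable X](_ : _ = \bigcap_(ps in [set: 'S_K * {ffun 'I_K -> bool}])
    [set x : T | 2 * kappa <=
      norm2 (projI Phi (Ip S ps.1) *m (Phi *m cps ps.1 ps.2 (tvec x)))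
      - \big[Num.max/0]_(I : {set 'I_K} | (#|I| <= S)%N && (I != Ip S ps.1))
          norm2 (projI Phi I *m (Phi *m cps ps.1 ps.2 (tvec x)))]).
  apply: fin_bigcap_measurable => [|[p sg] _ /=]; first exact: finite_finset.
  rewrite -[X in measurable X]setTI; apply: measurable_fun_le => //.
  have mn I : mfun (fun x => norm2 (projI Phi I *m (Phi *m cps p sg (tvec x)))).
    under eq_fun do rewrite mulmxA.
    by apply: measurable_norm2 => i; exact: measurable_cps.
  by apply: measurable_funB => //; exact: measurable_bigmax.
apply/seteqP; split => x /=.
  by move=> gap [p sg] _; exact: gap.
(* Arbitrary sign functions are recovered from the finite functions that make the intersection
   finite. *)
move=> gap p sg; have := gap (p, finfun sg) I.
by rewrite /= (_ : (finfun sg : 'I_K -> bool) = sg) //; apply/funext => i; rewrite ffunE.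
Qed.

Lemma measurable_best_Sterm S (Phi Psi : 'M[R]_(d, K)) :
  mfun (fun x => best_Sterm S Psi (Phi *m tvec x)).
Proof.
apply: measurable_bigmax => I; under eq_fun do rewrite mulmxA.
by apply: measurable_norm2sq => i; exact: measurable_tvec.
Qed.

Lemma measurable_signperm (s : 'S_K) (sg : 'I_K -> bool) :
  mfun (signperm s sg : T -> T).
Proof.
apply/measurable_fun_tnthP => i; rewrite /comp.
under eq_fun do rewrite tnth_mktuple.
by apply: measurable_funM; [exact: measurable_cst|exact: measurable_tnth].
Qed.

(** Change of variables: by symmetry the pushforward of [nu] agrees with [nu] on measurable sets. *)
Lemma ge0_integral_signperm (nu : probability T R) (f : T -> \bar R)
    (s : 'S_K) (sg : 'I_K -> bool) :
  symmetric_on_sphere nu -> mfun f -> (forall x, 0 <= f x)%E ->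
  (\int[nu]_x f (signperm s sg x) = \int[nu]_x f x)%E.
Proof.
move=> [_ sym] mf f0; have ms := measurable_signperm s sg.
rewrite -[LHS](ge0_integral_pushforward ms nu measurableT mf) => [|y _ //].
by apply: eq_measure_integral => A mA _; exact: sym.
Qed.

End Measurability.

Lemma best_Sterm_ge0 (R : realType) d K S (Psi : 'M[R]_(d, K)) (y : 'cV[R]_d) :
  0 <= best_Sterm S Psi y.
Proof. exact: bigmax_ge_id. Qed.

(** * Symmetrization of the objective *)

Section Objective.
Variables (R : realType) (d K S : nat) (nu : probability (K.-tuple R) R).
Hypothesis nu_sym : symmetric_on_sphere nu.
Local Notation signs := {ffun 'I_K -> bool}.

(** Every signed permutation gives the same integral. Multiplying by their number, rather than
    averaging, avoids division in the extended reals. *)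
Lemma objective_symmetrized (Phi Psi : 'M[R]_(d, K)) :
  (#|{: 'S_K * signs}|%:R%:E * objective S nu Phi Psi =
   \int[nu]_x (\sum_(p : 'S_K) \sum_(sg : signs)
     best_Sterm S Psi (Phi *m cps p sg (tvec x)))%:E)%E.
Proof.
pose f (ps : 'S_K * signs) (x : K.-tuple R) :=
  (best_Sterm S Psi (Phi *m tvec (signperm ps.1 ps.2 x)))%:E.
have mf0 : measurable_fun [set: K.-tuple R]
    (fun x => (best_Sterm S Psi (Phi *m tvec x))%:E).
  by apply/measurable_EFinP; exact: measurable_best_Sterm.
have mf ps : measurable_fun [set: K.-tuple R] (f ps).
  apply: (measurableT_comp (f := fun x => (best_Sterm S Psi (Phi *m tvec x))%:E)) => //.
  exact: measurable_signperm.
transitivity (\sum_(ps : 'S_K * signs) \int[nu]_x f ps x)%E.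
  rewrite (eq_bigr (fun=> objective S nu Phi Psi)) => [|[s sg] _].
    by rewrite sumr_const mule_natl.
  by apply: (ge0_integral_signperm (f := fun x => (best_Sterm S Psi (Phi *m tvec x))%:E)) => // x;
    rewrite lee_fin best_Sterm_ge0.
rewrite -ge0_integral_sum // => [|ps x _]; last by rewrite lee_fin best_Sterm_ge0.
apply: eq_integral => x _; rewrite sumEFin; congr _%:E.
have <- := sum_signperm_cps (fun z => best_Sterm S Psi (Phi *m z)) x.
by rewrite pair_big.
Qed.

(** Only orbit sums have to be compared almost surely; the positive finite factor cancels. *)
Lemma objective_le (Phi Psi : 'M[R]_(d, K)) :
  (\forall x \ae nu,
    \sum_(p : 'S_K) \sum_(sg : signs) best_Sterm S Psi (Phi *m cps p sg (tvec x))
    <= \sum_(p : 'S_K) \sum_(sg : signs) best_Sterm S Phi (Phi *m cps p sg (tvec x))) ->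
  (objective S nu Phi Psi <= objective S nu Phi Phi)%E.
Proof.
move=> ae_le.
have N0 : (0 < #|{: 'S_K * signs}|)%N by apply/card_gt0P; exists (1%g, [ffun=> false]).
rewrite -(@lee_pmul2l _ #|{: 'S_K * signs}|%:R%:E) ?lte_fin ?ltr0n //.
rewrite !objective_symmetrized.
have f0 (Theta : 'M[R]_(d, K)) (x : K.-tuple R) : [set: K.-tuple R] x ->
    (0 <= (\sum_(p : 'S_K) \sum_(sg : signs)
       best_Sterm S Theta (Phi *m cps p sg (tvec x)))%:E)%E.
  by move=> _; rewrite lee_fin; do 2![apply: sumr_ge0 => ? _]; exact: best_Sterm_ge0.
have mf (Theta : 'M[R]_(d, K)) : measurable_fun [set: K.-tuple R]
    (fun x => (\sum_(p : 'S_K) \sum_(sg : signs)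
       best_Sterm S Theta (Phi *m cps p sg (tvec x)))%:E).
  apply/measurable_EFinP; do 2![apply: measurable_sum => ?].
  apply: measurable_bigmax => I; under eq_fun do rewrite mulmxA.
  by apply: measurable_norm2sq => i; exact: measurable_cps.
apply: ae_ge0_le_integral => //; [exact: f0|exact: f0|].
by apply: filterS ae_le => x le_x _; rewrite lee_fin.
Qed.

End Objective.

Theorem theorem6 (R : realType) (d K S : nat) (Phi : 'M[R]_(d, K))
    (nu : probability (K.-tuple R) R) (kappa : R) :
  unit_norm_tight_frame Phi ->
  (1 <= S <= K)%N ->
  symmetric_on_sphere nu ->
  0 < kappa ->
  nu [set x | forall (p : 'S_K) (sg : 'I_K -> bool),
        2 * kappa <=
        norm2 (projI Phi (Ip S p) *m (Phi *m cps p sg (tvec x)))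
        - \big[Num.max/0]_(I : {set 'I_K} | (#|I| <= S)%N && (I != Ip S p))
              norm2 (projI Phi I *m (Phi *m cps p sg (tvec x)))] = 1%E ->
  local_max_on_D (objective S nu Phi) Phi.
Proof.
move=> tf hS sym k0 gap1; have [dict _] := tf; split => //.
have /andP[_ SK] := hS.
have ae_of_nu1 (A : set (K.-tuple R)) : measurable A -> nu A = 1%E ->
    \forall x \ae nu, A x.
  move=> mA A1; exists (~` A); split => //; first exact: measurableC.
  by rewrite probability_setC // A1 subee.
have ae_gap : \forall x \ae nu, gapped S Phi kappa (tvec x).
  by apply: ae_of_nu1 gap1; exact: measurable_gapped.
have ae_sphere : \forall x \ae nu, norm2sq (tvec x) = 1.
  apply: ae_of_nu1 (proj1 sym).
  have mn : measurable_fun [set: K.-tuple R] (fun x => norm2sq (tvec x)).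
    under eq_fun do rewrite -(mul1mx (tvec _)).
    by apply: measurable_norm2sq => i; exact: measurable_tvec.
  have := mn measurableT [set 1] (measurable_set1 _).
  by rewrite setTI.
(* The sum over all [I] bounds each individual perturbation constant, giving one radius for all
   supports. *)
pose C := \sum_(I : {set 'I_K}) 2 * frob2 (Defs.pinv (colsI Phi I)) * frob2 Phi.
have C_ge0 : 0 <= C by apply: sumr_ge0 => I _; rewrite !mulr_ge0 ?frob2_ge0.
(* This radius yields [(C + 1) * frob2 (Psi - Phi) <= kappa ^+ 2]; the added 1 keeps the divisor
   positive. *)
exists (kappa / Num.sqrt (C + 1)).
have sC : 0 < Num.sqrt (C + 1) by rewrite sqrtr_gt0 ltr_wpDl.
split; first exact: divr_gt0.
move=> Psi _; rewrite /frob_dist => dist.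
have close2 : (C + 1) * frob2 (Psi - Phi) <= kappa ^+ 2.
  have -> : frob2 (Psi - Phi) = \sum_i \sum_j (Psi i j - Phi i j) ^+ 2.
    by apply: eq_bigr => i _; apply: eq_bigr => j _; rewrite !mxE.
  move: dist; rewrite ltr_pdivlMr // => /ltW dist.
  have := lerXn2r 2 _ _ dist; rewrite ?nnegrE => h.
  rewrite -(sqr_sqrtr (addr_ge0 C_ge0 ler01)).
  rewrite -[X in _ * X <= _]sqr_sqrtr ?sumr_ge0 // => [|i _]; last first.
    by apply: sumr_ge0 => j _; exact: sqr_ge0.
  by rewrite -exprMn mulrC; apply: h; rewrite ?mulr_ge0 ?sqrtr_ge0 // ltW.
have close I :
    2 * frob2 (Defs.pinv (colsI Phi I)) * frob2 (Psi - Phi) * frob2 Phi <= kappa ^+ 2.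
  apply: le_trans close2; rewrite mulrAC ler_wpM2r ?frob2_ge0 //.
  apply: (@le_trans _ _ C); last by rewrite lerDl.
  rewrite /C (bigD1 I) //= lerDl; apply: sumr_ge0 => J _.
  by rewrite !mulr_ge0 ?frob2_ge0.
apply: objective_le => //.
apply: filterS2 ae_gap ae_sphere => x gap x1.
(* The chain compares the best value for [Psi], the value of [Psi] at [Ip S p], that of [Phi] at
   [Ip S p], and the best value for [Phi]; the middle comparison holds only after summing over the
   orbit. *)
apply: (@le_trans _ _ (\sum_(p : 'S_K) \sum_(sg : {ffun 'I_K -> bool})
    norm2sq (projI Psi (Ip S p) *m (Phi *m cps p sg (tvec x))))).
  apply: ler_sum => p _; apply: ler_sum => sg _.
  exact: best_Sterm_gapped gap close.
apply: (le_trans (sum_cps_projI_le Psi (tvec x) tf hS _)) => [I IS|].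
  exact: gapped_indepI gap IS.
apply: ler_sum => p _; apply: ler_sum => sg _.
by apply: (le_bigmax_cond _ (fun I => norm2sq (projI Phi I *m (Phi *m cps p sg (tvec x)))));
  exact: card_Ip_le.
Qed.
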